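(* Let $\mathcal{O}_{\mathsf{FF}_4}$ be the suboperad of $\mathsf{C}\mathbb{Z}$ generated by the four $\mathbb{Z}$-triangles $T(-1;-1,1)$, $T(-1;1,-1)$, $T(-1;1,1)$ and $T(1;-1,-1)$. The operad $\mathcal{O}_{\mathsf{FF}_4}$ is isomorphic to the operad $\mathcal{FF}_4$.
   Context: All vector spaces are over a field $\mathbb{K}$ of characteristic zero; $[n]=\{1,\dots,n\}$. Operad means nonsymmetric operad in vector spaces, graded by arities $n\ge1$. $\mathbb{Z}$ is the additive unitary magma of integers, with unit $0$. A $\mathbb{Z}$-clique $\mathfrak{p}$ of arity $n\ge1$ is a map assigning to every arc $(x,y)$, $1\le x<y\le n+1$, a label $\mathfrak{p}(x,y)\in\mathbb{Z}$; by convention, the only $\mathbb{Z}$-clique of arity $1$ is the one with $\mathfrak{p}(1,2)=0$. Put $\mathfrak{p}_0:=\mathfrak{p}(1,n+1)$ and $\mathfrak{p}_i:=\mathfrak{p}(i,i+1)$ for $i\in[n]$. $\mathsf{C}\mathbb{Z}$ is the operad whose space $\mathsf{C}\mathbb{Z}(n)$ is the linear span of all $\mathbb{Z}$-cliques of arity $n$, whose unit is the unique $\mathbb{Z}$-clique of arity $1$, and where, for $\mathbb{Z}$-cliques $\mathfrak{p},\mathfrak{q}$ of arities $n,m$ and $i\in[n]$, $\mathfrak{p}\circ_i\mathfrak{q}$ is the $\mathbb{Z}$-clique of arity $n+m-1$ with $$(\mathfrak{p}\circ_i\mathfrak{q})(x,y)=\begin{cases}\mathfrak{p}(x,y)&\text{if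 }y\le i,\\ \mathfrak{p}(x,y-m+1)&\text{if }x\le i<i+m\le y,\ (x,y)\ne(i,i+m),\\ \mathfrak{p}(x-m+1,y-m+1)&\text{if }i+m\le x,\\ \mathfrak{q}(x-i+1,y-i+1)&\text{if }i\le x<y\le i+m,\ (x,y)\ne(i,i+m),\\ \mathfrak{p}_i+\mathfrak{q}_0&\text{if }(x,y)=(i,i+m),\\ 0&\text{otherwise.}\end{cases}$$ $T(a;b,c)$ denotes the $\mathbb{Z}$-clique of arity $2$ (a $\mathbb{Z}$-triangle) with $\mathfrak{p}_0=a$, $\mathfrak{p}_1=b$, $\mathfrak{p}_2=c$. $\mathcal{FF}_4$ is the suboperad, of the operad $\mathcal{FF}$ of formal fractions of Chapoton, Hivert and Novelli, generated by the four binary formal fractions $A=\frac{1}{\{1\}\{1,2\}}$, $B=\frac{1}{\{2\}\{1,2\}}$, $C=\frac{1}{\{1,2\}}$, $D=\frac{1}{\{1\}\{2\}}$. Up to isomorphism, $\mathcal{FF}_4$ is the operad presented by the four binary generators $A,B,C,D$ and the eight relations $B\circ_1A=A\circ_2B$, $C\circ_1C=C\circ_2C$, $C\circ_1A=A\circ_2C$, $C\circ_1B=C\circ_2A$, $B\circ_1C=C\circ_2B$, $D\circ_1D=D\circ_2D$, $B\circ_1B=B\circ_2D$, $A\circ_1D=A\circ_2A$. *)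

(* Defs.v *)
(* MathComp world *)
From HB Require Import structures.
From mathcomp Require Import all_boot all_order all_algebra.
From mathcomp.multinomials Require Import freeg.
From mathcomp.classical Require Import boolp.
From mathcomp Require Import zify.

Set Implicit Arguments.
Unset Strict Implicit.
Unset Printing Implicit Defensive.

Import GRing.Theory.

Local Open Scope ring_scope.

(* Arities are at least 1, so the n-th component of an operad or set-operad
   below is the component of arity n.+1, and the inputs of an element of arity
   n.+1 are numbered from 0, by 'I_n.+1.  The composite of elements of arities
   n.+1 and m.+1 then has arity n.+1 + m.+1 - 1 = (n + m).+1. *)

Definition castar (P : nat -> Type) n m (e : n = m) (x : P n) : P m :=
  ecast k (P k) e x.

Record operad_laws (P : nat -> Type) (u : P 0)
    (c : forall n m, 'I_n.+1 -> P n -> P m -> P (n + m)%N) : Prop := OperadLaws {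
  comp_nested : forall n m l (i : 'I_n.+1) (j : 'I_m.+1) (k : 'I_(n + m).+1)
      (x : P n) (y : P m) (z : P l), k = (i + j)%N :> nat ->
    castar (addnA n m l) (c n (m + l)%N i x (c m l j y z)) =
    c (n + m)%N l k (c n m i x y) z;
  comp_parallel : forall n m l (i j : 'I_n.+1)
      (i' : 'I_(n + l).+1) (j' : 'I_(n + m).+1) (x : P n) (y : P m) (z : P l),
      (i < j)%N -> i' = i :> nat -> j' = (j + m)%N :> nat ->
    castar (addnAC n m l) (c (n + m)%N l j' (c n m i x y) z) =
    c (n + l)%N m i' (c n l j x z) y;
  comp_unitl : forall n (x : P n), c 0 n ord0 u x = x;
  comp_unitr : forall n (i : 'I_n.+1) (x : P n),
    castar (addn0 n) (c n 0 i x u) = x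
}.

Record set_operad := SetOperad {
  sop_space :> nat -> choiceType;
  sop_unit : sop_space 0;
  sop_comp : forall n m, 'I_n.+1 -> sop_space n -> sop_space m ->
    sop_space (n + m)%N;
  sop_laws : operad_laws sop_unit sop_comp
}.

Record operad (K : fieldType) := Operad {
  op_space :> nat -> lmodType K;
  op_unit : op_space 0;
  op_comp : forall n m, 'I_n.+1 -> op_space n -> op_space m ->
    op_space (n + m)%N;
  op_compl : forall n m i (y : op_space m), linear (@op_comp n m i ^~ y);
  op_compr : forall n m i (x : op_space n), linear (@op_comp n m i x);
  op_laws : operad_laws op_unit op_comp
}.

Arguments sop_comp {s n m} i x y.
Arguments op_comp {K o n m} i x y.

Record operad_iso (K : fieldType) (P Q : operad K)
    (f : forall n, {linear P n -> Q n}) : Prop := OperadIso {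
  iso_bij : forall n, bijective (f n);
  iso_unit : f 0 (op_unit P) = op_unit Q;
  iso_comp : forall n m (i : 'I_n.+1) (x : P n) (y : P m),
    f (n + m)%N (op_comp i x y) = op_comp i (f n x) (f m y)
}.

Definition operad_isomorphic (K : fieldType) (P Q : operad K) : Prop :=
  exists f : forall n, {linear P n -> Q n}, operad_iso f.

(* Bilinear extension of the composition of basis elements. *)
Definition lin_comp (K : fieldType) (P : set_operad) n m (i : 'I_n.+1)
    (x : {freeg (P n) / K}) (y : {freeg (P m) / K}) : {freeg (P (n + m)%N) / K} :=
  fglift (fun p => fglift (fun q => << sop_comp i p q >>) y) x.

Lemma fglift_linear (K : fieldType) (T : choiceType) (M : lmodType K)
  (f : T -> M) : linear (fglift f : {freeg T / K} -> M).
Proof.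
pose g := fglift f : {freeg T / K} -> M.
have gB : additive g := lift_is_additive f.
have g0 : g 0 = 0 by have := gB 0 0; rewrite !subrr.
have gD x y : g (x + y) = g x + g y.
  have gN z : g (- z) = - g z by have := gB 0 z; rewrite g0 !sub0r.
  by rewrite -{1}[y]opprK gB gN opprK.
move=> a x y; rewrite -/g gD; congr (_ + _).
have gS (s : seq T) (F : T -> {freeg T / K}) :
    g (\sum_(z <- s) F z) = \sum_(z <- s) g (F z).
  by elim: s => [|z s IHs]; rewrite ?big_nil // !big_cons gD IHs.
rewrite -{2}[x]freeg_sumE gS scaler_sumr.
have -> : a *: x = \sum_(z <- dom x) << a * coeff z x *g z >> by [].
by rewrite gS; apply: eq_bigr => z _; rewrite /g !liftU scalerA.
Qed.

Lemma freeg_linear_ext (K : fieldType) (T : choiceType) (M : lmodType K)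
    (f g : {freeg T / K} -> M) : linear f -> linear g ->
  (forall t, f << t >> = g << t >>) -> forall x, f x = g x.
Proof.
move=> lf lg fg x.
have lsum (h : {freeg T / K} -> M) : linear h ->
    h x = \sum_(t <- dom x) coeff t x *: h << t >>.
  move=> lh; have h0 : h 0 = 0.
    by have := lh 1 0 0; rewrite !scale1r addr0 -{1}[h 0]addr0 => /addrI.
  have hZ a y : h (a *: y) = a *: h y by have := lh a y 0; rewrite h0 !addr0.
  rewrite -{1}[x]freeg_sumE; elim: (dom x) => [|t s IHs].
    by rewrite !big_nil.
  rewrite !big_cons -IHs -[RHS]lh; congr (h (_ + _)).
  by apply/eqP/freeg_eqP => z; rewrite coeffZ !coeffU mul1r.
by rewrite (lsum f lf) (lsum g lg); apply: eq_bigr => t _; rewrite fg.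
Qed.

Lemma lin_comp_linl (K : fieldType) (P : set_operad) n m (i : 'I_n.+1)
  (y : {freeg (P m) / K}) : linear (lin_comp i ^~ y : {freeg (P n) / K} -> _).
Proof. exact: fglift_linear. Qed.

Lemma lin_comp_linr (K : fieldType) (P : set_operad) n m (i : 'I_n.+1)
  (x : {freeg (P n) / K}) : linear (lin_comp i x : {freeg (P m) / K} -> _).
Proof.
move=> a y z; rewrite /lin_comp.
pose h (p : P n) (y : {freeg (P m) / K}) : {freeg (P (n + m)%N) / K} :=
  fglift (fun q => << sop_comp i p q >>) y.
rewrite -/(fglift (h ^~ (a *: y + z)) x).
pose L y x := fglift (h ^~ y) x.
rewrite -/(L (a *: y + z) x) -/(L y x) -/(L z x).
apply: (freeg_linear_ext (f := L (a *: y + z))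
  (g := fun x => a *: L y x + L z x)).
- exact: fglift_linear.
- move=> b u v; rewrite /L !fglift_linear !scalerDr !scalerA mulrC.
  by rewrite -!addrA; congr (_ + _); rewrite addrCA.
- by move=> t; rewrite /L !liftU !scale1r; exact: fglift_linear.
Qed.

Lemma lin_compU (K : fieldType) (P : set_operad) n m (i : 'I_n.+1)
    (p : P n) (q : P m) :
  lin_comp i << p >> << q >> = << sop_comp i p q >> :> {freeg (P _) / K}.
Proof. by rewrite /lin_comp !liftU !scale1r. Qed.

Lemma castarU (K : fieldType) (P : set_operad) n m (e : n = m) (p : P n) :
  castar (P := fun k => {freeg (P k) / K}) e << p >> =
  << castar (P := fun k => P k) e p >>.
Proof. by case: m / e. Qed.

Lemma lin_laws (K : fieldType) (P : set_operad) :
  operad_laws (P := fun n => {freeg (P n) / K}) << sop_unit P >>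
    (fun n m i x y => lin_comp i x y).
Proof.
have dl n m (i : 'I_n.+1) a (x x' : {freeg (P n) / K}) (y : {freeg (P m) / K}) :
    lin_comp i (a *: x + x') y = a *: lin_comp i x y + lin_comp i x' y.
  exact: lin_comp_linl.
have dr n m (i : 'I_n.+1) a (x : {freeg (P n) / K}) (y y' : {freeg (P m) / K}) :
    lin_comp i x (a *: y + y') = a *: lin_comp i x y + lin_comp i x y'.
  exact: lin_comp_linr.
pose CT n m := @castar (fun n => {freeg (P n) / K}) n m.
have dc n m (e : n = m) (a : K) (x y : {freeg (P n) / K}) :
    CT n m e (a *: x + y) = a *: CT n m e x + CT n m e y.
  by case: m / e.
split.
- move=> n m l i j k x y z kE.
  apply: (freeg_linear_ext (f := fun x => CT _ _ _ (lin_comp i x (lin_comp j y z)))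
    (g := fun x => lin_comp k (lin_comp i x y) z)).
  + by move=> a u v; rewrite !(dl, dr, dc).
  + by move=> a u v; rewrite !(dl, dr, dc).
  move=> {x} p.
  apply: (freeg_linear_ext
    (f := fun y => CT _ _ _ (lin_comp i << p >> (lin_comp j y z)))
    (g := fun y => lin_comp k (lin_comp i << p >> y) z)).
  + by move=> a u v; rewrite !(dl, dr, dc).
  + by move=> a u v; rewrite !(dl, dr, dc).
  move=> {y} q.
  apply: (freeg_linear_ext
    (f := fun z => CT _ _ _ (lin_comp i << p >> (lin_comp j << q >> z)))
    (g := fun z => lin_comp k (lin_comp i << p >> << q >>) z)).
  + by move=> a u v; rewrite !(dl, dr, dc).
  + by move=> a u v; rewrite !(dl, dr, dc).
  move=> {z} r; rewrite /CT !lin_compU castarU.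
  by rewrite (comp_nested (sop_laws P) _ _ _ kE).
- move=> n m l i j i' j' x y z ij i'E j'E.
  apply: (freeg_linear_ext
    (f := fun x => CT _ _ _ (lin_comp j' (lin_comp i x y) z))
    (g := fun x => lin_comp i' (lin_comp j x z) y)).
  + by move=> a u v; rewrite !(dl, dr, dc).
  + by move=> a u v; rewrite !(dl, dr, dc).
  move=> {x} p.
  apply: (freeg_linear_ext
    (f := fun y => CT _ _ _ (lin_comp j' (lin_comp i << p >> y) z))
    (g := fun y => lin_comp i' (lin_comp j << p >> z) y)).
  + by move=> a u v; rewrite !(dl, dr, dc).
  + by move=> a u v; rewrite !(dl, dr, dc).
  move=> {y} q.
  apply: (freeg_linear_ext
    (f := fun z => CT _ _ _ (lin_comp j' (lin_comp i << p >> << q >>) z))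
    (g := fun z => lin_comp i' (lin_comp j << p >> z) << q >>)).
  + by move=> a u v; rewrite !(dl, dr, dc).
  + by move=> a u v; rewrite !(dl, dr, dc).
  move=> {z} r; rewrite /CT !lin_compU castarU.
  by rewrite (comp_parallel (sop_laws P) _ _ _ ij i'E j'E).
- move=> n x.
  apply: (freeg_linear_ext (f := fun x => lin_comp ord0 << sop_unit P >> x)
    (g := id)); [by move=> a u v; rewrite dr | by []|].
  by move=> {x} p; rewrite lin_compU (comp_unitl (sop_laws P)).
- move=> n i x.
  apply: (freeg_linear_ext
    (f := fun x => CT _ _ _ (lin_comp i x << sop_unit P >>)) (g := id)).
  + by move=> a u v; rewrite !(dl, dr, dc).
  + by [].
  by move=> {x} p; rewrite /CT lin_compU castarU (comp_unitr (sop_laws P)).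
Qed.

Definition linear_operad (K : fieldType) (P : set_operad) : operad K :=
  @Operad K (fun n => {freeg (P n) / K}) << sop_unit P >>
    (fun n m i x y => lin_comp i x y)
    (@lin_comp_linl K P) (@lin_comp_linr K P) (lin_laws K P).

Record is_suboperad (K : fieldType) (P : operad K)
    (S : forall n, P n -> Prop) : Prop := IsSuboperad {
  subop0 : forall n, S n 0;
  subopL : forall n (a : K) (x y : P n), S n x -> S n y -> S n (a *: x + y);
  subop_unit : S 0 (op_unit P);
  subop_comp : forall n m (i : 'I_n.+1) (x : P n) (y : P m),
    S n x -> S m y -> S (n + m)%N (op_comp i x y)
}.

(* The intersection of all suboperads containing G. *)
Definition generated (K : fieldType) (P : operad K) (G : forall n, P n -> Prop)
    n : pred (P n) :=
  fun x => `[< forall S : forall n, P n -> Prop, is_suboperad S ->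
    (forall m (y : P m), G m y -> S m y) -> S n x >].

Lemma generated_submod (K : fieldType) (P : operad K)
  (G : forall n, P n -> Prop) n : GRing.subsemimod_closed (generated G (n := n)).
Proof.
have gL a x y : generated G x -> generated G y -> generated G (a *: x + y) (n := n).
  move=> /asboolP gx /asboolP gy; apply/asboolP => S Sop SG.
  by apply: subopL => //; [exact: gx | exact: gy].
have g0 : generated G (0 : P n) by apply/asboolP => S Sop _; exact: subop0.
split; first split => //.
- by move=> x y gx gy; rewrite unfold_in -[x]scale1r; exact: gL.
- by move=> a x gx; rewrite unfold_in -[_ *: _]addr0; exact: gL.
Qed.

HB.instance Definition _ (K : fieldType) (P : operad K)
    (G : forall n, P n -> Prop) n :=
  GRing.isSubmodClosed.Build K (P n) (generated G (n := n))
    (generated_submod G n).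

Definition gen_space (K : fieldType) (P : operad K) (G : forall n, P n -> Prop)
  n := {x : P n | generated G x}.

HB.instance Definition _ (K : fieldType) (P : operad K)
  (G : forall n, P n -> Prop) n := SubChoice.on (gen_space G n).
HB.instance Definition _ (K : fieldType) (P : operad K)
    (G : forall n, P n -> Prop) n :=
  [SubChoice_isSubLmodule of gen_space G n by <:].

Lemma generated_unit (K : fieldType) (P : operad K)
  (G : forall n, P n -> Prop) : generated G (op_unit P).
Proof. by apply/asboolP => S Sop _; exact: subop_unit. Qed.

Lemma generated_comp (K : fieldType) (P : operad K) (G : forall n, P n -> Prop)
    n m (i : 'I_n.+1) (x : P n) (y : P m) :
  generated G x -> generated G y -> generated G (op_comp i x y).
Proof.
move=> /asboolP gx /asboolP gy; apply/asboolP => S Sop SG.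
by apply: subop_comp => //; [exact: gx | exact: gy].
Qed.

Definition gen_unit (K : fieldType) (P : operad K)
  (G : forall n, P n -> Prop) : gen_space G 0 :=
  exist (fun x => generated G x) _ (generated_unit G).

Definition gen_comp (K : fieldType) (P : operad K) (G : forall n, P n -> Prop)
    n m (i : 'I_n.+1) (x : gen_space G n) (y : gen_space G m) :
    gen_space G (n + m)%N :=
  exist (fun x => generated G x) _ (generated_comp i (valP x) (valP y)).

Lemma gen_compl (K : fieldType) (P : operad K) (G : forall n, P n -> Prop)
  n m (i : 'I_n.+1) (y : gen_space G m) :
  linear (fun x : gen_space G n => gen_comp i x y).
Proof. by move=> a x x'; apply: val_inj; rewrite linearP /= op_compl. Qed.

Lemma gen_compr (K : fieldType) (P : operad K) (G : forall n, P n -> Prop)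
  n m (i : 'I_n.+1) (x : gen_space G n) :
  linear (fun y : gen_space G m => gen_comp i x y).
Proof. by move=> a y y'; apply: val_inj; rewrite linearP /= op_compr. Qed.

Lemma gen_laws (K : fieldType) (P : operad K) (G : forall n, P n -> Prop) :
  operad_laws (P := gen_space G) (gen_unit G) (@gen_comp K P G).
Proof.
have valc n m (e : n = m) (x : gen_space G n) :
    val (castar (P := gen_space G) e x) = castar (P := fun k => P k) e (val x).
  by case: m / e.
split.
- move=> n m l i j k x y z kE; apply: val_inj; rewrite valc.
  exact: (comp_nested (op_laws P)).
- move=> n m l i j i' j' x y z ij i'E j'E; apply: val_inj; rewrite valc.
  exact: (comp_parallel (op_laws P)).
- by move=> n x; apply: val_inj; exact: (comp_unitl (op_laws P)).
- move=> n i x; apply: val_inj; rewrite valc.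
  exact: (comp_unitr (op_laws P)).
Qed.

Definition generated_operad (K : fieldType) (P : operad K)
    (G : forall n, P n -> Prop) : operad K :=
  @Operad K (gen_space G) (gen_unit G) (@gen_comp K P G)
    (@gen_compl K P G) (@gen_compr K P G) (gen_laws G).

(* The component of arity 2 is the one of index 1. *)
Definition binary_gens (K : fieldType) (P : operad K) (s : seq (P 1)) n :
    P n -> Prop :=
  if n is 1 then fun x => x \in s else fun=> False.

(* The vertices 1, ..., n+2 of a Z-clique of arity n.+1 are numbered from 0. *)
Definition arc n : finType := {a : 'I_n.+2 * 'I_n.+2 | (a.1 < a.2)%N}.

(* The labels of a Z-clique of arity 1 (n = 0) are forced to be 0. *)
Definition clique n : choiceType :=
  {p : {ffun arc n -> int} | (n == 0)%N ==> (p == [ffun=> 0])}.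

(* Label of (x, y), and 0 if (x, y) is not an arc. *)
Definition label n (p : clique n) (x y : nat) : int :=
  oapp (val p) 0
    [pick a : arc n | ((val a).1 == x :> nat) && ((val a).2 == y :> nat)].

Fact mkclique_subproof n (f : nat -> nat -> int) :
  (n == 0)%N ==> ([ffun a : arc n => if (n == 0)%N then 0
                  else f (val a).1 (val a).2] == [ffun=> 0]).
Proof. by apply/implyP => n0; apply/eqP/ffunP => a; rewrite !ffunE n0. Qed.

Definition mkclique n (f : nat -> nat -> int) : clique n :=
  exist (fun p : {ffun arc n -> int} => (n == 0)%N ==> (p == [ffun=> 0])) _
    (mkclique_subproof n f).

(* The case y = i + m.+1 of the arc (i, i + m.+1) comes first; the remaining
   cases are pairwise disjoint. *)
Definition clique_comp n m (i : 'I_n.+1) (p : clique n) (q : clique m) :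
    clique (n + m)%N :=
  mkclique (n + m)%N (fun x y =>
    if (x == i) && (y == i + m.+1)%N then label p i i.+1 + label q 0 m.+1
    else if (y <= i)%N then label p x y
    else if (x <= i)%N && (i + m < y)%N then label p x (y - m)
    else if (i + m < x)%N then label p (x - m) (y - m)
    else if (i <= x)%N && (y <= i + m.+1)%N then label q (x - i) (y - i)
    else 0).

Lemma label_mk n f x y : label (mkclique n f) x y =
  if [&& n != 0, x < y & y < n.+2]%N then f x y else 0.
Proof.
rewrite /label; case: pickP => [[[a b] ab]|no] /=.
  have ab' : (a < b)%N := ab.
  case/andP => /eqP ax /eqP by_; rewrite ffunE /=.
  rewrite -ax -by_ ab' ltn_ord andbT /=.
  by case: ifP.
case: ifP => // /and3P[_ xy yn].
have xn := ltn_trans xy yn.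
by have := no (exist _ (Ordinal xn, Ordinal yn) xy); rewrite /= !eqxx.
Qed.

Lemma label_arc n (p : clique n) (a : arc n) :
  label p (val a).1 (val a).2 = val p a.
Proof.
rewrite /label; case: pickP => [b|/(_ a)]; last by rewrite !eqxx.
case/andP => /eqP/val_inj b1 /eqP/val_inj b2 /=; congr (val p _).
by apply: val_inj; case: (val b) (val a) b1 b2 => [? ?] [? ?] /= -> ->.
Qed.

Lemma label_out n (p : clique n) x y :
  ~~ [&& n != 0, x < y & y < n.+2]%N -> label p x y = 0.
Proof.
rewrite /label; case: pickP => //= -[[a b] ab] /=.
have ab' : (a < b)%N := ab.
case/andP => /eqP ax /eqP by_.
rewrite -ax -by_ ab' ltn_ord !andbT negbK => n0.
by have /implyP/(_ n0)/eqP := valP p => /ffunP/(_ _) ->; rewrite ffunE.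
Qed.

Lemma label_inj n (p q : clique n) :
  (forall x y, (n != 0)%N -> (x < y < n.+2)%N -> label p x y = label q x y) -> p = q.
Proof.
move=> pq; apply/val_inj/ffunP => a; rewrite -!label_arc.
case: (boolP (n == 0)%N) => n0; first by rewrite !label_out // n0.
by apply: pq; rewrite // (valP a) ltn_ord.
Qed.

Definition labelif (b : bool) n (p : clique n) x y := if b then label p x y else 0.

(* The vertex x of a composite lies on the first factor unless
   i < x < i + m.+1, and to_p sends it to the corresponding vertex. *)
Definition on_p i m x := ((x <= i) || (i + m < x))%N.
Definition to_p i m x := (minn x i + (x - (i + m)))%N.

Lemma labelif_out (b : bool) n (p : clique n) x y :
  (b -> ~~ (x < y < n.+2)%N || (n == 0)%N) -> labelif b p x y = 0.
Proof.
rewrite /labelif; case: b => // /(_ isT) h; apply: label_out.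
by case: (n == 0)%N h; rewrite ?orbF.
Qed.

Lemma labelif_eq (b c : bool) n (p : clique n) x y x' y' : b = c ->
  (b -> x = x' /\ y = y') -> labelif b p x y = labelif c p x' y'.
Proof. by move=> <-; rewrite /labelif; case: b => // /(_ isT)[-> ->]. Qed.

Lemma labelif_comp b n m (i : 'I_n.+1) (p : clique n) (q : clique m) x y :
  labelif b (clique_comp i p q) x y =
    labelif [&& b, on_p i m x & on_p i m y] p (to_p i m x) (to_p i m y) +
    labelif [&& b, i <= x & y <= i + m.+1]%N q (x - i) (y - i).
Proof.
case: b; last by rewrite /labelif addr0.
rewrite !andTb {1}/labelif label_mk; move: (nat_of_ord i) (ltn_ord i) => {i} i in_.
case: ifP => [/and3P[nm xy yn]|out]; last first.
  by rewrite !labelif_out ?addr0 // /on_p /to_p; lia.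
case: ifP => [c|c1].
  rewrite -/(labelif true p _ _) -/(labelif true q _ _).
  congr (_ + _); apply: labelif_eq; rewrite /on_p /to_p; lia.
case: ifP => [c|c2].
  rewrite -/(labelif true p _ _) [X in _ = _ + X]labelif_out ?addr0; last by lia.
  by apply: labelif_eq; rewrite /on_p /to_p; lia.
case: ifP => [c|c3].
  rewrite -/(labelif true p _ _) [X in _ = _ + X]labelif_out ?addr0; last by lia.
  by apply: labelif_eq; rewrite /on_p /to_p; lia.
case: ifP => [c|c4].
  rewrite -/(labelif true p _ _) [X in _ = _ + X]labelif_out ?addr0; last by lia.
  by apply: labelif_eq; rewrite /on_p /to_p; lia.
rewrite [X in _ = X + _]labelif_out ?add0r; last by rewrite /on_p /to_p; lia.
case: ifP => [c|c5].
  by rewrite -/(labelif true q _ _); apply: labelif_eq; lia.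
by rewrite labelif_out; last lia.
Qed.

Lemma clique_eq n (p q : clique n) :
  (forall x y, (x < y)%N -> labelif true p x y = labelif true q x y) -> p = q.
Proof. by move=> pq; apply: label_inj => x y _ /andP[xy _]; exact: pq. Qed.

Lemma labelif_cast b n m (e : n = m) (p : clique n) x y :
  labelif b (castar (P := clique) e p) x y = labelif b p x y.
Proof. by case: m / e. Qed.

Lemma labelif_unit b x y : labelif b (mkclique 0 (fun _ _ => 0)) x y = 0.
Proof. by rewrite labelif_out // eqxx orbT. Qed.

Lemma on_p_nested m l i j x : (j < m.+1)%N ->
  on_p (i + j) l x && on_p i m (to_p (i + j) l x) = on_p i (m + l) x.
Proof. by rewrite /on_p /to_p; lia. Qed.

Lemma to_p_nested m l i j x : (j < m.+1)%N -> on_p i (m + l) x ->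
  to_p i m (to_p (i + j) l x) = to_p i (m + l) x.
Proof. by rewrite /on_p /to_p; lia. Qed.

Lemma on_p_parallel n m l i j x : (i < n.+1)%N -> (j < n.+1)%N -> (i < j)%N ->
  on_p (j + m) l x && on_p i m (to_p (j + m) l x) =
  on_p i m x && on_p j l (to_p i m x).
Proof. by rewrite /on_p /to_p; lia. Qed.

Lemma to_p_parallel n m l i j x : (i < n.+1)%N -> (j < n.+1)%N -> (i < j)%N ->
  on_p (j + m) l x && on_p i m (to_p (j + m) l x) ->
  to_p i m (to_p (j + m) l x) = to_p j l (to_p i m x).
Proof. by rewrite /on_p /to_p; lia. Qed.

Lemma on_q_parallel m l i j x y : (i < j)%N -> (x < y)%N ->
  [&& on_p (j + m) l x && on_p (j + m) l y,
    i <= to_p (j + m) l x & to_p (j + m) l y <= i + m.+1]%N =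
  ((i <= x) && (y <= i + m.+1))%N.
Proof. by rewrite /on_p /to_p => ij xy; apply/idP/idP; lia. Qed.

Lemma clique_laws : operad_laws (P := clique) (mkclique 0 (fun _ _ => 0))
  (fun n m i p q => clique_comp i p q).
Proof.
split.
- move=> n m l i j k p q r kE; apply: clique_eq => x y xy.
  rewrite labelif_cast !labelif_comp kE -addrA.
  move: (nat_of_ord i) (ltn_ord i) (nat_of_ord j) (ltn_ord j) => {kE i j k} i in_ j jm.
  have onE z := @on_p_nested m l i j z jm.
  have toE z := @to_p_nested m l i j z jm.
  congr (_ + (_ + _)); apply: labelif_eq.
  + by move: (onE x) (onE y); do 6!case: (on_p _ _ _).
  + by rewrite /= => /andP[ax ay]; rewrite !toE.
  + by rewrite /on_p /to_p; apply/idP/idP; lia.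
  + by rewrite /to_p => /and3P[_ ix iy]; split; lia.
  + by rewrite /on_p /to_p; apply/idP/idP; lia.
  + lia.
- move=> n m l i j i' j' p q r ij i'E j'E; apply: clique_eq => x y xy.
  rewrite labelif_cast !labelif_comp i'E j'E addrAC {i'E j'E i' j'}.
  move: (nat_of_ord i) (ltn_ord i) (nat_of_ord j) (ltn_ord j) ij => {i j} i in_ j jn ij.
  have onE z := @on_p_parallel n m l i j z in_ jn ij.
  have toE z := @to_p_parallel n m l i j z in_ jn ij.
  congr (_ + _ + _); apply: labelif_eq.
  + by move: (onE x) (onE y); do 8!case: (on_p _ _ _).
  + by rewrite /= => /andP[/andP[ax ay] /andP[bx by_]]; rewrite !toE ?ax ?ay.
  + by rewrite /on_p /to_p; apply/idP/idP; lia.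
  + by rewrite /on_p /to_p; lia.
  + exact: on_q_parallel.
  + by rewrite /on_p /to_p; lia.
- move=> n p; apply: clique_eq => x y xy.
  rewrite labelif_comp labelif_unit add0r !subn0.
  case: (boolP (x < y < n.+2)%N) => xyn; last by rewrite !labelif_out // xyn.
  by apply: labelif_eq => //=; lia.
- move=> n i p; apply: clique_eq => x y xy.
  rewrite labelif_cast labelif_comp labelif_unit addr0.
  by apply: labelif_eq; rewrite /on_p /to_p; lia.
Qed.

Definition clique_operad : set_operad := SetOperad clique_laws.

(* A formal fraction of arity n.+1 is a product of integer powers of formal
   symbols {S}, one for each nonempty set S of inputs; it is encoded by its
   exponents, and common factors are cancelled. *)
Definition symbol n : finType := {S : {set 'I_n.+1} | S != set0}.

Definition fraction n : choiceType := {ffun symbol n -> int}.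

(* The product of the symbols in num divided by the product of those in den. *)
Definition mkfraction n (num den : seq {set 'I_n.+1}) : fraction n :=
  [ffun U => (count_mem (val U) num)%:Z - (count_mem (val U) den)%:Z].

(* In a composite at input i, the inputs i, ..., i + m are those of the second
   factor: a symbol {S} of the first factor becomes {inflate m i S}, where i is
   replaced by i, ..., i + m, and a symbol {T} of the second factor becomes
   {translate i T}. *)
Definition collapse n m (i : 'I_n.+1) (u : 'I_(n + m).+1) : 'I_n.+1 :=
  inord (if (u < i)%N then u : nat else if (u <= i + m)%N then i : nat
         else (u - m)%N).

Definition inflate n m (i : 'I_n.+1) (S : {set 'I_n.+1}) :
  {set 'I_(n + m).+1} := [set u | collapse i u \in S].

Definition translate n m (i : 'I_n.+1) (S : {set 'I_m.+1}) :
  {set 'I_(n + m).+1} := [set inord (i + v)%N | v : 'I_m.+1 in S].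

Definition block n m (i : 'I_n.+1) : {set 'I_(n + m).+1} :=
  [set u : 'I_(n + m).+1 | (i <= u <= i + m)%N].

(* As for moulds, the composite of f and g at i is
     {i, ..., i + m} . f(..., {i, ..., i + m}, ...) . g(i, ..., i + m),
   with the extra factor {i, ..., i + m}. *)
Definition fraction_comp n m (i : 'I_n.+1) (f : fraction n) (g : fraction m) :
    fraction (n + m)%N :=
  [ffun U => \sum_(S : symbol n | inflate m i (val S) == val U) f S
           + \sum_(T : symbol m | translate i (val T) == val U) g T
           + (val U == block m i)%:Z].

Definition nmem n (S : {set 'I_n.+1}) (x : nat) : bool :=
  [exists u, (u \in S) && (u == x :> nat)].

Lemma nmemE n (S : {set 'I_n.+1}) (u : 'I_n.+1) : nmem S u = (u \in S).
Proof.
apply/existsP/idP => [[v /andP[vS /eqP/val_inj <-]]|uS] //.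
by exists u; rewrite uS eqxx.
Qed.

Lemma nmem_out n (S : {set 'I_n.+1}) x : (n < x)%N -> nmem S x = false.
Proof.
move=> nx; apply/existsP => -[u /andP[_ /eqP ux]].
by have := ltn_ord u; rewrite ux; lia.
Qed.

Lemma nmem_inj n (S T : {set 'I_n.+1}) : nmem S =1 nmem T -> S = T.
Proof. by move=> ST; apply/setP => u; rewrite -!nmemE ST. Qed.

Lemma nmem_def n (S : {set 'I_n.+1}) (A : pred nat) :
    (forall u : 'I_n.+1, (u \in S) = A u) -> (forall x, A x -> (x <= n)%N) ->
  nmem S =1 A.
Proof.
move=> SA An x; case: (leqP x n) => xn.
  by rewrite -[x]/(Ordinal (xn : (x < n.+1)%N) : nat) nmemE SA.
by rewrite nmem_out //; apply/esym/negP => /An; lia.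
Qed.

Lemma collapseE n m (i : 'I_n.+1) (u : 'I_(n + m).+1) :
  collapse i u = to_p i m u :> nat.
Proof.
have in_ := ltn_ord i; have um := ltn_ord u.
rewrite /collapse /to_p; case: ifP => [?|?]; last case: ifP => [?|?].
all: by rewrite inordK; lia.
Qed.

Lemma nmem_inflate n m (i : 'I_n.+1) (S : {set 'I_n.+1}) :
  nmem (inflate m i S) =1 fun x => nmem S (to_p i m x).
Proof.
have in_ := ltn_ord i; apply: nmem_def => [u|y].
  by rewrite inE -nmemE collapseE.
by case: (leqP y (n + m)) => // yn; rewrite nmem_out // /to_p; lia.
Qed.

Lemma nmem_translate n m (i : 'I_n.+1) (S : {set 'I_m.+1}) :
  nmem (translate i S) =1 fun x => (i <= x)%N && nmem S (x - i).
Proof.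
have in_ := ltn_ord i.
apply: nmem_def => [u|y].
  apply/imsetP/andP => [[v vS ->]|[iu /existsP[v /andP[vS /eqP ve]]]].
    have vm := ltn_ord v; rewrite inordK; last by lia.
    by rewrite addKn nmemE vS leq_addr.
  by exists v => //; apply: val_inj; rewrite /= ve subnKC // inordK.
case/andP=> iy; case: (leqP y (n + m)) => // yn.
by rewrite nmem_out //; lia.
Qed.

Lemma nmem_block n m (i : 'I_n.+1) :
  nmem (block m i) =1 fun x => (i <= x <= i + m)%N.
Proof.
have in_ := ltn_ord i.
by apply: nmem_def => [u|y]; [rewrite inE | lia].
Qed.

Lemma eq_nmem n n' (S T : {set 'I_n.+1}) (S' T' : {set 'I_n'.+1}) :
  n = n' -> nmem S =1 nmem S' -> nmem T =1 nmem T' -> (S == T) = (S' == T').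
Proof.
move=> nn; case: n' / nn S' T' => S' T' SS TT.
by rewrite (nmem_inj SS) (nmem_inj TT).
Qed.

(* Direct image of exponents. *)
Definition push n n' (phi : {set 'I_n.+1} -> {set 'I_n'.+1}) (f : fraction n)
  (U : {set 'I_n'.+1}) : int := \sum_(S : symbol n | phi (val S) == U) f S.

Lemma push_eq n n1 n2 (phi1 : {set 'I_n.+1} -> {set 'I_n1.+1})
    (phi2 : {set 'I_n.+1} -> {set 'I_n2.+1}) (f : fraction n) U V : n1 = n2 ->
  (forall S, nmem (phi1 S) =1 nmem (phi2 S)) -> nmem U =1 nmem V ->
  push phi1 f U = push phi2 f V.
Proof. by move=> nn pp UV; apply: eq_bigl => S; exact: eq_nmem. Qed.

Lemma inflate_neq0 n m (i : 'I_n.+1) (S : {set 'I_n.+1}) :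
  S != set0 -> inflate m i S != set0.
Proof.
case/set0Pn => v vS; apply/set0Pn.
have in_ := ltn_ord i; have vn := ltn_ord v.
have h : nmem (inflate m i S) (if (v <= i)%N then v : nat else (v + m)%N).
  move: vS; rewrite nmem_inflate -nmemE; congr (is_true (nmem S _)).
  by rewrite /to_p; case: ifP => ?; lia.
by case/existsP: h => u /andP[uS _]; exists u.
Qed.

Lemma translate_neq0 n m (i : 'I_n.+1) (S : {set 'I_m.+1}) :
  S != set0 -> translate i S != set0.
Proof.
case/set0Pn=> v vS; apply/set0Pn.
by exists (inord (i + v)%N); apply/imsetP; exists v.
Qed.

Lemma block_neq0 n m (i : 'I_n.+1) : block m i != set0.
Proof.
apply/set0Pn; have in_ := ltn_ord i.
by exists (inord i); rewrite inE inordK; lia.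
Qed.

Lemma push_sum n n' (phi : {set 'I_n.+1} -> {set 'I_n'.+1}) (I : finType)
    (psi : I -> {set 'I_n.+1}) (F : I -> int) U :
  (forall t, psi t != set0) ->
  push phi [ffun V : symbol n => \sum_(t | psi t == val V) F t] U =
  \sum_(t | phi (psi t) == U) F t.
Proof.
move=> psi0; rewrite /push; under eq_bigr do rewrite ffunE.
rewrite (exchange_big_dep (fun t => phi (psi t) == U)) /=; last first.
  by move=> S t /eqP <- /eqP ->.
apply: eq_bigr => t /eqP <-.
rewrite (bigD1 (exist _ (psi t) (psi0 t) : symbol n)) /= ?eqxx //.
rewrite big1 ?addr0 // => S /andP[/andP[_ /eqP pS] /eqP []].
exact: val_inj.
Qed.

Lemma push_comp n m n' (phi : {set 'I_(n + m).+1} -> {set 'I_n'.+1})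
    (i : 'I_n.+1) (f : fraction n) (g : fraction m) U :
  push phi (fraction_comp i f g) U =
  push (fun S => phi (inflate m i S)) f U + push (fun S => phi (translate i S)) g U
  + (phi (block m i) == U)%:Z.
Proof.
have b0 := @block_neq0 n m i.
pose b1 : fraction (n + m)%N :=
  [ffun V => \sum_(t : 'I_1 | block m i == val V) 1%:Z].
pose f1 : fraction (n + m)%N :=
  [ffun V => \sum_(t : symbol n | inflate m i (val t) == val V) f t].
pose g1 : fraction (n + m)%N :=
  [ffun V => \sum_(t : symbol m | translate i (val t) == val V) g t].
have -> : push phi (fraction_comp i f g) U = push phi f1 U + push phi g1 U + push phi b1 U.
  rewrite /push -!big_split; apply: eq_bigr => V _; rewrite !ffunE /=.
  by congr (_ + _); rewrite eq_sym; case: eqP => _; rewrite ?big_ord1 // big_pred0.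
rewrite !push_sum => [|t|t|t]; first last.
- exact: inflate_neq0 (valP t).
- exact: translate_neq0 (valP t).
- exact: block_neq0.
by congr (_ + _); case: eqP => _; rewrite ?big_ord1 // big_pred0.
Qed.

Lemma fraction_compE n m (i : 'I_n.+1) (f : fraction n) (g : fraction m) U :
  fraction_comp i f g U = push (inflate m i) f (val U) +
    push (translate i) g (val U) + (block m i == val U)%:Z.
Proof. by rewrite /fraction_comp ffunE [val U == _]eq_sym. Qed.

Lemma fraction_cast_eq n n' (e : n = n') (f : fraction n) (g : fraction n') :
  (forall U V, nmem (val U) =1 nmem (val V) -> f U = g V) ->
  castar (P := fraction) e f = g.
Proof. by case: n' / e g => g fg; apply/ffunP => U; exact: fg. Qed.

Lemma push_id n (f : fraction n) U : push id f (val U) = f U.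
Proof. by rewrite /push (eq_bigl (pred1 U)) ?big_pred1_eq. Qed.

Definition fraction_unit : fraction 0 := mkfraction [::] [:: [set ord0]].

Lemma push_unit n (phi : {set 'I_1} -> {set 'I_n.+1}) U :
  push phi fraction_unit U = - (phi [set ord0] == U)%:Z.
Proof.
have u0 : [set ord0 : 'I_1] != set0 by apply/set0Pn; exists ord0; rewrite inE.
pose s0 : symbol 0 := exist (fun S : {set 'I_1} => S != set0) _ u0.
have all0 (S : symbol 0) : S = s0.
  apply/val_inj/setP => v; rewrite /= inE (ord1 v) eqxx.
  by have /set0Pn[w] := valP S; rewrite (ord1 w).
rewrite /push; case: (boolP (phi [set ord0] == U)) => pU.
  rewrite (big_pred1 s0) => [|S]; first by rewrite ffunE /= eqxx.
  by rewrite [S]all0 /= eqxx -pU.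
by rewrite big_pred0 // => S; rewrite [S]all0; exact: negbTE.
Qed.

Lemma iverson_eq n n' (S T : {set 'I_n.+1}) (S' T' : {set 'I_n'.+1}) :
  n = n' -> nmem S =1 nmem S' -> nmem T =1 nmem T' ->
  (S == T)%:Z = (S' == T')%:Z.
Proof. by move=> nn SS TT; rewrite (eq_nmem nn SS TT). Qed.

Lemma fraction_laws : operad_laws (P := fraction) fraction_unit
  (fun n m i f g => fraction_comp i f g).
Proof.
have nestE (a b c d e : int) : a + (b + c + d) + e = a + b + e + c + d by lia.
have parE (a b c d e : int) : a + b + d + c + e = a + c + e + b + d by lia.
split.
- move=> n m l i j k f g h kE; apply: fraction_cast_eq => U V UV.
  have in_ := ltn_ord i; have jm := ltn_ord j; have nml := addnA n m l.
  rewrite !fraction_compE !push_comp nestE.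
  congr (_ + _ + _ + _ + _); (apply: push_eq || apply: iverson_eq) => //.
  + move=> S x; rewrite !nmem_inflate kE; congr (nmem S _).
    by rewrite /to_p; lia.
  + move=> S x; rewrite nmem_translate !nmem_inflate nmem_translate kE.
    by congr (_ && nmem S _); rewrite /to_p; lia.
  + by move=> x; rewrite nmem_inflate !nmem_block kE /to_p; lia.
  + by move=> S x; rewrite !nmem_translate kE andbA subnDA; congr (_ && _); lia.
  + by move=> x; rewrite nmem_translate !nmem_block kE; lia.
- move=> n m l i j i' j' f g h ij i'E j'E; apply: fraction_cast_eq => U V UV.
  have in_ := ltn_ord i; have jn := ltn_ord j; have nml := addnAC n m l.
  rewrite !fraction_compE !push_comp parE.
  congr (_ + _ + _ + _ + _); (apply: push_eq || apply: iverson_eq) => //.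
  all: try (move=> S x; rewrite !(nmem_inflate, nmem_translate) i'E j'E).
  all: try (move=> x; rewrite !(nmem_inflate, nmem_translate, nmem_block) i'E j'E).
  + by congr (nmem S _); rewrite /to_p; lia.
  + by congr (_ && nmem S _); rewrite /to_p; lia.
  + by rewrite /to_p; lia.
  + case: (leqP x (i + m)) => xm.
      by congr (_ && nmem S _); rewrite /to_p; lia.
    by rewrite !nmem_out ?andbF //; rewrite /to_p; lia.
  + by rewrite /to_p; lia.
- move=> n f; apply/ffunP => U.
  rewrite fraction_compE push_unit.
  have -> : inflate n ord0 [set ord0] = block n (ord0 : 'I_1).
    apply/setP => u; rewrite !inE; have := ltn_ord u.
    by rewrite (ord1 (collapse _ _)) eqxx /=; lia.
  rewrite addrAC addNr add0r -[RHS]push_id; apply: push_eq => // S x.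
  by rewrite nmem_translate subn0.
- move=> n i f; apply: fraction_cast_eq => U V UV.
  rewrite fraction_compE push_unit.
  have -> : translate i [set ord0] = block 0 i.
    apply: nmem_inj => x; rewrite nmem_translate nmem_block.
    have nm0 y : nmem [set ord0 : 'I_1] y = (y == 0%N).
      by apply: (nmem_def (A := pred1 0%N)) => [u|z /eqP ->] //; rewrite inE ord1.
    by rewrite nm0; lia.
  rewrite addrNK -[RHS]push_id; apply: push_eq => //; first by rewrite addn0.
  by move=> S x; rewrite nmem_inflate; congr (nmem S _); rewrite /to_p; lia.
Qed.

Definition fraction_operad : set_operad := SetOperad fraction_laws.

Definition triangle (a b c : int) : clique 1 :=
  mkclique 1 (fun x y => match x, y with
                         | 0, 2 => a
                         | 0, 1 => b
                         | _, _ => c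
                         end%N).

Definition CZ (K : fieldType) : operad K := linear_operad K clique_operad.

Definition OFF4 (K : fieldType) : operad K :=
  generated_operad (binary_gens (P := CZ K)
    [:: << triangle (-1) (-1) 1 >>; << triangle (-1) 1 (-1) >>;
        << triangle (-1) 1 1 >>; << triangle 1 (-1) (-1) >>]).

Definition FF (K : fieldType) : operad K := linear_operad K fraction_operad.

(* The inputs 1 and 2 are ord0 and ord_max. *)
Definition FF4 (K : fieldType) : operad K :=
  let s1 : {set 'I_2} := [set ord0] in
  let s2 : {set 'I_2} := [set ord_max] in
  let s12 : {set 'I_2} := [set ord0; ord_max] in
  generated_operad (binary_gens (P := FF K)
    [:: << mkfraction [::] [:: s1; s12] >>; << mkfraction [::] [:: s2; s12] >>;
        << mkfraction [::] [:: s12] >>; << mkfraction [::] [:: s1; s2] >>]).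

(* Main.v *)
From mathcomp Require Import all_boot all_order all_algebra.
From HB Require Import structures.
From mathcomp.multinomials Require Import freeg.
From mathcomp.classical Require Import boolp.
From mathcomp Require Import zify.
Require Import Defs.

Set Implicit Arguments.
Unset Strict Implicit.
Unset Printing Implicit Defensive.

Import GRing.Theory.

Local Open Scope ring_scope.

(** The isomorphism comes from an injection at the level of bases. The arc
    (x, y) of a clique corresponds to the interval {x, ..., y - 1} of inputs:
    the edges of the polygon are the single inputs, its base is the set of all
    inputs. Under this correspondence, the composite of two fractions whose
    symbols are all intervals combines exponents as the composite of two
    cliques combines labels, except on the arc along which the two polygons
    are glued: there p_i + q_0 is replaced by e_i + e_0 + 1, because of the
    extra factor of the mould composition.

    The change of variables p = 2 e + s removes the discrepancy, where s(x, y)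
    counts in how many ways the arc (x, y) is a side of the polygon (0 for a
    diagonal, 1 for an edge or the base, 2 for the only arc of arity 1). On the
    glued arc, [(2 e_i + 1) + (2 e_0 + 1) = 2 (e_i + e_0 + 1)], which is the
    right label for a diagonal ([nb_sides_comp] handles all arcs at once, units
    included). In arity 1 the label 0 gives the exponent -1, that of the unit
    fraction. In arity 2, labels 1 and -1 become exponents 0 and -1, so that
    the four triangles become the four fractions.

    The inverse change of variables needs labels congruent to s modulo 2. The
    cliques with this property ([even_clique]) form a set-suboperad that
    contains the triangles, and on it [clique_fraction] is an injective
    morphism ([clique_fraction_comp], [clique_fraction_inj]). It remains to
    linearise: a morphism that is injective on a suboperad restricts to an
    isomorphism between the suboperads generated by a family in it and by the
    image of this family ([generated_isomorphic], [linear_operad_isomorphic]). *)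

(** * Generated suboperads and injective morphisms *)

Lemma linear_pack (K : fieldType) (U V : lmodType K) (f : U -> V) :
  linear f -> {g : {linear U -> V} | g =1 f}.
Proof.
move=> lf; pose L := GRing.isLinear.Build K U V *:%R f lf.
by exists (HB.pack_for {linear U -> V} f L).
Qed.

Lemma generated_min (K : fieldType) (P : operad K)
    (G S : forall n, P n -> Prop) :
  is_suboperad S -> (forall n (x : P n), G n x -> S n x) ->
  forall n (x : P n), generated G x -> S n x.
Proof. by move=> Sop GS n x /asboolP; apply. Qed.

Lemma generated_suboperad (K : fieldType) (P : operad K)
  (G : forall n, P n -> Prop) : is_suboperad (fun n x => generated G (n := n) x).
Proof.
split.
- by move=> n; apply/asboolP => S Sop _; exact: subop0.
- move=> n a x y /asboolP gx /asboolP gy; apply/asboolP => S Sop SG.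
  by apply: subopL => //; [exact: gx | exact: gy].
- exact: generated_unit.
- by move=> n m i x y; exact: generated_comp.
Qed.

Lemma generated_gen (K : fieldType) (P : operad K) (G : forall n, P n -> Prop)
  n (x : P n) : G n x -> generated G x.
Proof. by move=> Gx; apply/asboolP => S _; apply. Qed.

(** The elements that [f] sends into the suboperad generated by [H] form a
    suboperad containing [G], and the image of the one generated by [G] is a
    suboperad containing [H]: so [f] restricts to a surjection. Multiplicativity
    and injectivity are asked only on [S], because the natural map between the
    ambient operads need not have them everywhere. *)
Lemma generated_isomorphic (K : fieldType) (P Q : operad K)
    (f : forall n, {linear P n -> Q n}) (S : forall n, P n -> Prop)
    (G : forall n, P n -> Prop) (H : forall n, Q n -> Prop) :
    is_suboperad S ->
    f 0%N (op_unit P) = op_unit Q ->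
    (forall n m (i : 'I_n.+1) (x : P n) (y : P m), S n x -> S m y ->
      f (n + m)%N (op_comp i x y) = op_comp i (f n x) (f m y)) ->
    (forall n (x y : P n), S n x -> S n y -> f n x = f n y -> x = y) ->
    (forall n (x : P n), G n x -> S n x) ->
    (forall n (y : Q n), H n y <-> exists2 x, G n x & f n x = y) ->
  operad_isomorphic (generated_operad G) (generated_operad H).
Proof.
move=> Sop f1 fM fI GS HE.
have genS := generated_min Sop GS.
have gP := generated_suboperad G; have gQ := generated_suboperad H.
have fgen n (x : P n) : generated G x -> generated H (f n x).
  move=> gx.
  suff [_ //] : S n x /\ generated H (f n x).
  move: n x gx; apply: generated_min => [|n x Gx]; last first.
    split; first exact: GS.
    by apply: generated_gen; apply/HE; exists x.
  split.
  - by move=> n; split; [exact: subop0 | rewrite linear0; exact: subop0 gQ n].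
  - move=> n a x y [Sx Hx] [Sy Hy]; split; first exact: subopL.
    by rewrite linearP; exact: (subopL gQ).
  - by split; [exact: subop_unit | rewrite f1; exact: subop_unit gQ].
  - move=> n m i x y [Sx Hx] [Sy Hy]; split; first exact: subop_comp.
    by rewrite fM //; exact: (subop_comp gQ).
have fsurj n (y : Q n) : generated H y -> exists2 x, generated G x & f n x = y.
  move: n y; apply: generated_min => [|n y /HE[x Gx <-]]; last first.
    by exists x => //; exact: generated_gen.
  split.
  - by move=> n; exists 0; [exact: subop0 gP n | rewrite linear0].
  - move=> n a _ _ [x gx <-] [y gy <-]; exists (a *: x + y).
      exact: (subopL gP).
    by rewrite linearP.
  - by exists (op_unit P) => //; exact: subop_unit gP.
  - move=> n m i _ _ [x gx <-] [y gy <-]; exists (op_comp i x y).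
      exact: (subop_comp gP).
    by rewrite fM //; exact: genS.
pose g n (x : gen_space G n) : gen_space H n :=
  exist (fun y => generated H y) _ (fgen n _ (valP x)).
have lg n : linear (@g n) by move=> a x y; apply: val_inj; rewrite /= linearP.
pose h n := linear_pack (lg n).
exists (fun n => sval (h n)); split.
- move=> n; have E : sval (h n) =1 @g n := svalP (h n).
  have [inv invP] : {inv : gen_space H n -> gen_space G n &
      forall y, f n (val (inv y)) = val y}.
    apply: (choice (X := gen_space H n) (Y := gen_space G n)
      (P := fun y x => f n (val x) = val y)) => y.
    have [x gx fx] := fsurj n _ (valP y).
    by exists (exist (fun x => generated G x) x gx).
  exists inv => x; last by rewrite E; apply: val_inj; exact: invP.
  rewrite E; apply: val_inj; apply: (fI n); try exact: genS (valP _).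
  by rewrite invP.
- by rewrite (svalP (h 0%N)); apply: val_inj; exact: f1.
- move=> n m i x y; rewrite !(svalP (h _)); apply: val_inj => /=.
  by rewrite fM //; exact: genS (valP _).
Qed.

(** * Operads spanned by set-operads *)

(** Given inductively, so that a statement linear in its argument reduces to
    basis elements by induction. *)
Inductive basis_span (K : fieldType) (T : choiceType) (A : T -> Prop) :
    {freeg T / K} -> Prop :=
| basis_span0 : basis_span A 0
| basis_spanU t : A t -> basis_span A << t >>
| basis_spanL a x y : basis_span A x -> basis_span A y -> basis_span A (a *: x + y).

Lemma basis_span_suboperad (K : fieldType) (P : set_operad)
    (A : forall n, P n -> Prop) :
    A 0%N (sop_unit P) ->
    (forall n m (i : 'I_n.+1) (p : P n) (q : P m), A n p -> A m q ->
      A (n + m)%N (sop_comp i p q)) ->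
  is_suboperad (P := linear_operad K P) (fun n => basis_span (A n) (K := K)).
Proof.
move=> A1 AM; split=> [n|n a x y||n m i x y Sx Sy] /=.
- exact: basis_span0.
- exact: basis_spanL.
- exact: basis_spanU.
- have l0 (U V : lmodType K) (f : U -> V) : linear f -> f 0 = 0.
    by move=> /linear_pack[g <-]; rewrite linear0.
  elim: Sx => [|p Ap|a x1 x2 _ S1 _ S2]; last 1 first.
  + by rewrite lin_comp_linl; exact: basis_spanL.
  + by rewrite (l0 _ _ _ (lin_comp_linl i y)); exact: basis_span0.
  elim: Sy => [|q Aq|a y1 y2 _ S1 _ S2]; last 1 first.
  + by rewrite lin_comp_linr; exact: basis_spanL.
  + by rewrite (l0 _ _ _ (lin_comp_linr i _)); exact: basis_span0.
  by rewrite lin_compU; exact/basis_spanU/AM.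
Qed.

Lemma basis_span_eq (K : fieldType) (T : choiceType) (A : T -> Prop) (V : lmodType K)
    (f g : {freeg T / K} -> V) : linear f -> linear g ->
  (forall t, A t -> f << t >> = g << t >>) -> forall x, basis_span A x -> f x = g x.
Proof.
move=> lf lg fg x; elim=> [|t|a y z _ IHy _ IHz]; last 1 first.
- by rewrite lf lg IHy IHz.
- by have [f' <-] := linear_pack lf; have [g' <-] := linear_pack lg; rewrite !linear0.
- exact: fg.
Qed.

(** A partial inverse of [f], extended by 0 outside the image of [A], gives a
    linear left inverse of [F] on the span of [A]. *)
Lemma fglift_basis_span_inj (K : fieldType) (T U : choiceType) (A : T -> Prop)
    (f : T -> U) (F := fglift (fun t => << f t >>) : {freeg T / K} -> {freeg U / K}) :
    (forall s t, A s -> A t -> f s = f t -> s = t) ->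
  forall x y, basis_span A x -> basis_span A y -> F x = F y -> x = y.
Proof.
move=> fI.
have [g gP] : {g : U -> {freeg T / K} & forall t, A t -> g (f t) = << t >>}.
  pose R u (y : {freeg T / K}) := forall t, A t -> f t = u -> y = << t >>.
  have [u|g gP] := choice (X := U) (Y := {freeg T / K}) (P := R); last first.
    by exists g => t At; exact: gP.
  have [[t At fu]|no] := pselect (exists2 t, A t & f t = u).
    by exists << t >> => s As fs; congr << _ >>; apply: fI; rewrite // fs.
  by exists 0 => t At ft; case: no; exists t.
pose G := fglift g : {freeg U / K} -> {freeg T / K}.
have GF x : basis_span A x -> G (F x) = x.
  apply: (basis_span_eq (f := G \o F) (g := id)) => [||t At] //.
    by move=> a y z; rewrite /= /F /G !fglift_linear.
  by rewrite /= /G /F !(liftU, scale1r) gP.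
by move=> x y /GF Ex /GF Ey Fxy; rewrite -Ex -Ey Fxy.
Qed.

(** Passes from bases to operads: a map that is multiplicative and injective on
    a set-suboperad [A] has a linear extension with the same properties on the
    span of [A]. *)
Lemma linear_operad_isomorphic (K : fieldType) (P Q : set_operad)
    (A : forall n, P n -> Prop) (f : forall n, P n -> Q n)
    (s : seq (P 1%N)) :
    A 0%N (sop_unit P) ->
    (forall n m (i : 'I_n.+1) (p : P n) (q : P m), A n p -> A m q ->
      A (n + m)%N (sop_comp i p q)) ->
    f 0%N (sop_unit P) = sop_unit Q ->
    (forall n m (i : 'I_n.+1) (p : P n) (q : P m), A n p -> A m q ->
      f (n + m)%N (sop_comp i p q) = sop_comp i (f n p) (f m q)) ->
    (forall n (p q : P n), A n p -> A n q -> f n p = f n q -> p = q) ->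
    (forall p, p \in s -> A 1%N p) ->
  operad_isomorphic
    (generated_operad (binary_gens (P := linear_operad K P)
      [seq << p >> | p <- s]))
    (generated_operad (binary_gens (P := linear_operad K Q)
      [seq << f 1%N p >> | p <- s])).
Proof.
move=> A1 AM f1 fM fI As.
pose F n : {freeg (P n) / K} -> {freeg (Q n) / K} := fglift (fun p => << f n p >>).
have lF n : linear (@F n) by exact: fglift_linear.
have FU n p : F n << p >> = << f n p >> by rewrite /F liftU scale1r.
pose L n := linear_pack (lF n).
have LE n : sval (L n) =1 F n := svalP (L n).
apply: (generated_isomorphic (P := linear_operad K P) (Q := linear_operad K Q)
  (f := fun n => sval (L n)) (S := fun n => basis_span (A n) (K := K))).
- exact: basis_span_suboperad.
- by rewrite LE FU f1.
- move=> n m i x y Sx Sy; rewrite !LE /=.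
  pose G1 x y := F (n + m)%N (lin_comp i x y).
  pose G2 x y := lin_comp i (F n x) (F m y).
  apply: (basis_span_eq (f := G1 ^~ y) (g := G2 ^~ y)) Sx => [a u v|a u v|p Ap].
  + by rewrite /G1 lin_comp_linl lF.
  + by rewrite /G2 lF lin_comp_linl.
  apply: (basis_span_eq (f := G1 _) (g := G2 _)) Sy => [a u v|a u v|q Aq].
  + by rewrite /G1 lin_comp_linr lF.
  + by rewrite /G2 lF lin_comp_linr.
  by rewrite /G1 /G2 !(FU, lin_compU) fM.
- by move=> n x y Sx Sy; rewrite !LE; exact: (fglift_basis_span_inj (@fI n)) Sx Sy.
- by case=> [|[|n]] //= x /mapP[p /As Ap ->]; exact: basis_spanU.
- case=> [|[|n]] //= y; try by split=> // -[? []].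
  split=> [/mapP[p ps ->]|[_ /mapP[p ps ->]]].
    by exists << p >>; [exact: (map_f (fun p => << p >>)) | rewrite LE FU].
  by rewrite LE FU => <-; exact: (map_f (fun p => << f 1%N p >>)).
Qed.

(** * From labels to exponents *)

(** The two summands test for an edge and for the base; in arity 1 the only arc
    is both, and counts twice. *)
Definition nb_sides n (x y : nat) : int :=
  (y == x.+1)%N%:Z + ((x == 0) && (y == n.+1))%N%:Z.

Definition exponent n (p : clique n) (x y : nat) : int :=
  ((label p x y - nb_sides n x y) %/ 2)%Z.

Definition even_clique n (p : clique n) : Prop :=
  forall x y, (x < y < n.+2)%N -> (2 %| label p x y - nb_sides n x y)%Z.

Lemma label_exponent n (p : clique n) x y : even_clique p -> (x < y < n.+2)%N ->
  label p x y = exponent p x y * 2 + nb_sides n x y.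
Proof. by move=> ep /ep xy; rewrite /exponent; lia. Qed.

Lemma label_clique_comp n m (i : 'I_n.+1) (p : clique n) (q : clique m) x y :
  label (clique_comp i p q) x y =
    labelif (on_p i m x && on_p i m y) p (to_p i m x) (to_p i m y) +
    labelif ((i <= x) && (y <= i + m.+1))%N q (x - i) (y - i).
Proof. by have := labelif_comp true i p q x y. Qed.

(** The sides of a composite polygon are those of its two factors, except that
    the two sides glued along the arc (i, i + m.+1) are lost. This holds even
    when a factor has arity 1, because its only arc counts twice. *)
Lemma nb_sides_comp n m i x y : (i < n.+1)%N -> (x < y < (n + m).+2)%N ->
  nb_sides (n + m) x y + ((x == i) && (y == i + m.+1))%N%:Z * 2 =
    (if on_p i m x && on_p i m y then nb_sides n (to_p i m x) (to_p i m y) else 0) +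
    (if (i <= x)%N && (y <= i + m.+1)%N then nb_sides m (x - i) (y - i) else 0).
Proof.
rewrite /nb_sides /on_p /to_p => in_ xyn.
case: ifP => h1; case: ifP => h2.
(* The conditions of both factors meet only on the glued arc. *)
- have [-> ->] : x = i /\ y = (i + m.+1)%N by lia.
  have -> : minn i i = i by lia.
  have -> : minn (i + m.+1) i = i by lia.
  have -> : (i - (i + m) = 0)%N by lia.
  have -> : (i + m.+1 - (i + m) = 1)%N by lia.
  have -> : (i + m.+1 - i = m.+1)%N by lia.
  have -> : (i - i = 0)%N by lia.
  have -> : (i + m.+1 == i.+1)%N = (m == 0)%N by lia.
  have -> : ((i == 0) && (i + m.+1 == (n + m).+1))%N = (n == 0)%N by lia.
  have -> : ((i + 0 == 0) && (i + 1 == n.+1))%N = (n == 0)%N by lia.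
  have -> : (i + 1 == (i + 0).+1)%N by lia.
  have -> : (m.+1 == 1)%N = (m == 0)%N by lia.
  by rewrite !eqxx; lia.
- have -> : ((x == i) && (y == i + m.+1))%N = false by lia.
  rewrite mul0r !addr0; congr ((nat_of_bool _)%:Z + (nat_of_bool _)%:Z); lia.
- have -> : ((x == i) && (y == i + m.+1))%N = false by lia.
  rewrite mul0r addr0 add0r; congr ((nat_of_bool _)%:Z + (nat_of_bool _)%:Z); lia.
- have -> : ((x == i) && (y == i + m.+1))%N = false by lia.
  have -> : (y == x.+1)%N = false by lia.
  by have -> : ((x == 0) && (y == (n + m).+1))%N = false by lia.
Qed.

(** What the composition of fractions prescribes for the exponent of the
    interval of the arc (x, y); the last summand is the extra factor. *)
Definition exponent_sum n m i (p : clique n) (q : clique m) x y : int :=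
  (if on_p i m x && on_p i m y then exponent p (to_p i m x) (to_p i m y) else 0) +
  (if (i <= x)%N && (y <= i + m.+1)%N then exponent q (x - i) (y - i) else 0) +
  ((x == i) && (y == i + m.+1))%N%:Z.

Lemma label_comp_exponent n m (i : 'I_n.+1) (p : clique n) (q : clique m) x y :
    even_clique p -> even_clique q -> (x < y < (n + m).+2)%N ->
  label (clique_comp i p q) x y = exponent_sum i p q x y * 2 + nb_sides (n + m) x y.
Proof.
move=> ep eq_ xyn; have in_ := ltn_ord i.
have := nb_sides_comp in_ xyn.
rewrite label_clique_comp /labelif /exponent_sum.
case: ifP => [ponp|_]; last first.
all: case: ifP => [qonq|_].
all: try (rewrite (label_exponent ep); last by move: ponp; rewrite /on_p /to_p; lia).
all: try (rewrite (label_exponent eq_); last by lia).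
all: lia.
Qed.

Lemma exponent_comp n m (i : 'I_n.+1) (p : clique n) (q : clique m) x y :
    even_clique p -> even_clique q -> (x < y < (n + m).+2)%N ->
  exponent (clique_comp i p q) x y = exponent_sum i p q x y.
Proof.
by move=> ep eq_ xyn; rewrite /exponent label_comp_exponent //; lia.
Qed.

Lemma even_clique_comp n m (i : 'I_n.+1) (p : clique n) (q : clique m) :
  even_clique p -> even_clique q -> even_clique (clique_comp i p q).
Proof.
by move=> ep eq_ x y xyn; rewrite label_comp_exponent //; lia.
Qed.

(** * Arcs as intervals of inputs *)

Definition arc_set n (a : arc n) : {set 'I_n.+1} :=
  [set u : 'I_n.+1 | ((val a).1 <= u < (val a).2)%N].

Lemma nmem_arc_set n (a : arc n) :
  nmem (arc_set a) =1 fun x => ((val a).1 <= x < (val a).2)%N.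
Proof.
by apply: nmem_def => [u|x]; [rewrite inE | have := ltn_ord (val a).2; lia].
Qed.

Lemma arc_eq n (a b : arc n) : (val a).1 = (val b).1 :> nat ->
  (val a).2 = (val b).2 :> nat -> a = b.
Proof.
case: a b => [[a1 a2] a12] [[b1 b2] b12] /= e1 e2; apply: val_inj => /=.
by rewrite (val_inj e1) (val_inj e2).
Qed.

Lemma arc_set_inj n : injective (@arc_set n).
Proof.
move=> a b ab.
have E x : ((val a).1 <= x < (val a).2)%N = ((val b).1 <= x < (val b).2)%N.
  by rewrite -!nmem_arc_set ab.
have ha : ((val a).1 < (val a).2)%N := valP a.
have hb : ((val b).1 < (val b).2)%N := valP b.
have := E (val a).1; have := E (val b).1.
have := E (val a).2.-1; have := E (val b).2.-1.
by move=> *; apply: arc_eq; lia.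
Qed.

Lemma arc_set_neq0 n (a : arc n) : arc_set a != set0.
Proof.
apply/set0Pn; have ha : ((val a).1 < (val a).2)%N := valP a.
have := ltn_ord (val a).2 => a2.
by exists (inord (val a).1); rewrite inE inordK; lia.
Qed.

(** * The fraction of a clique *)

(** The symbols that are not intervals get the empty sum, hence exponent 0. *)
Definition clique_fraction n (p : clique n) : fraction n :=
  [ffun U => \sum_(a : arc n | arc_set a == val U)
     exponent p (val a).1 (val a).2].

Definition arc_symbol n (a : arc n) : symbol n :=
  exist _ (arc_set a) (arc_set_neq0 a).

Lemma clique_fraction_arc n (p : clique n) (a : arc n) :
  clique_fraction p (arc_symbol a) = exponent p (val a).1 (val a).2.
Proof.
by rewrite ffunE (big_pred1 a) // => b; rewrite /= (inj_eq (@arc_set_inj n)).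
Qed.

(** Distinct arcs have distinct intervals, so the fraction determines all
    exponents, and an even clique is determined by its exponents. *)
Lemma clique_fraction_inj n (p q : clique n) : even_clique p -> even_clique q ->
  clique_fraction p = clique_fraction q -> p = q.
Proof.
move=> ep eq_ pq; apply/val_inj/ffunP => a; rewrite -!label_arc.
have xyn : ((val a).1 < (val a).2 < n.+2)%N by rewrite ltn_ord andbT; exact: valP a.
rewrite !label_exponent //; congr (_ * 2 + _).
by rewrite -!clique_fraction_arc pq.
Qed.

Definition mkarc n x y (xyn : (x < y < n.+2)%N) : arc n :=
  exist _ (Ordinal (ltn_trans (proj1 (andP xyn)) (proj2 (andP xyn))),
           Ordinal (proj2 (andP xyn))) (proj1 (andP xyn)).

(** A section of [to_p i m], with values in the vertices that satisfy [on_p]. *)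
Definition from_p i m x := if (x <= i)%N then x else (x + m)%N.

Fact inflate_arc_subproof n m (i : 'I_n.+1) (a : arc n) :
  (from_p i m (val a).1 < from_p i m (val a).2 < (n + m).+2)%N.
Proof.
have ha : ((val a).1 < (val a).2)%N := valP a.
have := ltn_ord (val a).2; have := ltn_ord i; rewrite /from_p.
by do 2!case: ifP => ?; lia.
Qed.

Definition inflate_arc n m (i : 'I_n.+1) (a : arc n) : arc (n + m) :=
  mkarc (inflate_arc_subproof m i a).

Lemma arc_set_inflate n m (i : 'I_n.+1) (a : arc n) :
  arc_set (inflate_arc m i a) = inflate m i (arc_set a).
Proof.
have /= ha : ((val a).1 < (val a).2)%N := valP a.
apply: nmem_inj => x; rewrite nmem_inflate !nmem_arc_set /= /from_p /to_p.
by do 2!case: ifP => ?; lia.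
Qed.

Fact translate_arc_subproof n m (i : 'I_n.+1) (a : arc m) :
  (i + (val a).1 < i + (val a).2 < (n + m).+2)%N.
Proof.
have ha : ((val a).1 < (val a).2)%N := valP a.
have := ltn_ord (val a).2; have := ltn_ord i; lia.
Qed.

Definition translate_arc n m (i : 'I_n.+1) (a : arc m) : arc (n + m) :=
  mkarc (translate_arc_subproof i a).

Lemma arc_set_translate n m (i : 'I_n.+1) (a : arc m) :
  arc_set (translate_arc i a) = translate i (arc_set a).
Proof.
by apply: nmem_inj => x; rewrite nmem_translate !nmem_arc_set /=; lia.
Qed.

Fact block_arc_subproof n m (i : 'I_n.+1) : (i < i + m.+1 < (n + m).+2)%N.
Proof. by have := ltn_ord i; lia. Qed.

Definition block_arc n m (i : 'I_n.+1) : arc (n + m) :=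
  mkarc (block_arc_subproof m i).

Lemma arc_set_block n m (i : 'I_n.+1) : arc_set (block_arc m i) = block m i.
Proof.
by apply: nmem_inj => x; rewrite nmem_block nmem_arc_set /=; lia.
Qed.

(** Reindexes a push-forward of exponents along the embedding [phi] of a
    polygon into a composite one: [R] describes the image of [phi], and [g]
    inverts it on vertices. *)
Lemma sum_arc_image n n' (phi : arc n -> arc n') (R : pred (arc n'))
    (F : nat -> nat -> int) (g : nat -> nat) (U : {set 'I_n'.+1}) :
    injective phi ->
    (forall a, R (phi a) /\ g (val (phi a)).1 = (val a).1 /\
               g (val (phi a)).2 = (val a).2) ->
    (forall c, R c -> exists a, phi a = c) ->
  \sum_(a | arc_set (phi a) == U) F (val a).1 (val a).2 =
  \sum_(c | arc_set c == U)
    (if R c then F (g (val c).1) (g (val c).2) else 0).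
Proof.
move=> phiI Rphi phiS.
rewrite (partition_big phi (fun c => arc_set c == U)) //=.
apply: eq_bigr => c /eqP cU; case: ifP => Rc; last first.
  apply: big_pred0 => a; apply/negP => /andP[_ /eqP ac].
  by have [] := Rphi a; rewrite ac Rc.
have [a ac] := phiS c Rc; rewrite (big_pred1 a) => [|b].
  by have [_ [e1 e2]] := Rphi a; rewrite -ac e1 e2.
apply/andP/eqP => [[_ /eqP bc]|->]; first by apply: phiI; rewrite bc.
by rewrite ac cU.
Qed.

(** Inflation, translation and block formation on sets of inputs all come from
    operations on arcs, so the three contributions to the exponent of a
    composite fraction are the three terms of [exponent_sum]. *)
Lemma clique_fraction_comp n m (i : 'I_n.+1) (p : clique n) (q : clique m) :
    even_clique p -> even_clique q ->
  clique_fraction (clique_comp i p q) =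
  fraction_comp i (clique_fraction p) (clique_fraction q).
Proof.
move=> ep eq_; have in_ := ltn_ord i.
apply/ffunP => U; rewrite fraction_compE !push_sum; try exact: arc_set_neq0.
rewrite ffunE.
under eq_bigr => c _.
  rewrite exponent_comp // /exponent_sum; last by rewrite ltn_ord andbT; exact: valP c.
  over.
rewrite !big_split /=.
congr (_ + _ + _).
- under [RHS]eq_bigl do rewrite -arc_set_inflate.
  symmetry; apply: (@sum_arc_image _ _ (inflate_arc m i)
    (fun c => on_p i m (val c).1 && on_p i m (val c).2) _ (to_p i m)) => [a b ab|a|c Rc].
  + have := congr1 (fun c : arc (n + m) => to_p i m (val c).1) ab.
    have := congr1 (fun c : arc (n + m) => to_p i m (val c).2) ab.
    by rewrite /= /to_p /from_p; do 4!case: ifP => ?; move=> *; apply: arc_eq => /=; lia.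
  + have ha : ((val a).1 < (val a).2)%N := valP a.
    move: ha; rewrite /= /on_p /to_p /from_p.
    by do 2!case: ifP => ?; move=> ha; (split; [|split]); lia.
  + have hc : ((val c).1 < (val c).2)%N := valP c.
    have c2 := ltn_ord (val c).2.
    have xy : (to_p i m (val c).1 < to_p i m (val c).2 < n.+2)%N.
      by move: Rc; rewrite /to_p /on_p; lia.
    exists (mkarc xy); apply: arc_eq; move: Rc hc; rewrite /= /to_p /on_p /from_p;
      case: ifP => ?; lia.
- under [RHS]eq_bigl do rewrite -arc_set_translate.
  symmetry; apply: (@sum_arc_image _ _ (translate_arc i)
    (fun c => (i <= (val c).1)%N && ((val c).2 <= i + m.+1)%N) _
    (fun x => (x - i)%N)) => [a b ab|a|c Rc].
  + have := congr1 (fun c : arc (n + m) => nat_of_ord (val c).1) ab.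
    have := congr1 (fun c : arc (n + m) => nat_of_ord (val c).2) ab.
    by rewrite /= => *; apply: arc_eq => /=; lia.
  + by have := ltn_ord (val a).2; rewrite /= => a2; (split; [|split]); lia.
  + have hc : ((val c).1 < (val c).2)%N := valP c.
    have xy : ((val c).1 - i < (val c).2 - i < m.+2)%N by lia.
    by exists (mkarc xy); apply: arc_eq; move: Rc hc => /=; lia.
- rewrite -arc_set_block.
  have E (c : arc (n + m)) :
      ((val c).1 == i :> nat) && ((val c).2 == (i + m.+1)%N :> nat) =
             (c == block_arc m i).
    apply/andP/eqP => [[/eqP c1 /eqP c2]|->]; first exact: arc_eq.
    by rewrite /= !eqxx.
  under eq_bigr do rewrite E.
  case: (boolP (arc_set _ == _)) => bU.
    rewrite (bigD1 (block_arc m i)) //= eqxx big1 ?addr0 // => c /andP[_ /negbTE ->].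
    by [].
  by apply: big1 => c cU; case: eqP => // cb; rewrite -cb cU in bU.
Qed.

Lemma even_clique_unit : even_clique (sop_unit clique_operad).
Proof.
move=> x y xy; rewrite label_out ?eqxx // /nb_sides; lia.
Qed.

Lemma clique_fraction_unit :
  clique_fraction (sop_unit clique_operad) = fraction_unit.
Proof.
apply/ffunP => U.
have UE : val U = [set ord0].
  have /set0Pn[w wU] := valP U.
  by apply/setP => v; rewrite inE (ord1 v) eqxx -(ord1 w).
have aU (a : arc 0) : arc_set a == val U.
  rewrite UE; apply/eqP/setP => u; rewrite !inE (ord1 u) eqxx.
  by have := valP a; have := ltn_ord (val a).2; rewrite /=; lia.
rewrite !ffunE (big_pred1 (mkarc (isT : (0 < 1 < 2)%N))).
  by rewrite /exponent label_out /= ?UE ?eqxx.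
move=> a; rewrite aU; apply/esym/eqP/arc_eq;
  have := valP a; have := ltn_ord (val a).2; rewrite /=; lia.
Qed.

(** * The generators *)

Lemma even_triangle (a b c : int) :
  ~~ (2 %| a)%Z -> ~~ (2 %| b)%Z -> ~~ (2 %| c)%Z -> even_clique (triangle a b c).
Proof.
move=> ha hb hc x y xy; rewrite label_mk xy /nb_sides /=.
have [[-> ->]|[[-> ->]|[-> ->]]] :
  (x = 0 /\ y = 1 \/ x = 1 /\ y = 2 \/ x = 0 /\ y = 2)%N by lia.
all: rewrite /=; lia.
Qed.

Definition left_edge : arc 1 := mkarc (isT : (0 < 1 < 3)%N).
Definition right_edge : arc 1 := mkarc (isT : (1 < 2 < 3)%N).
Definition base_arc : arc 1 := mkarc (isT : (0 < 2 < 3)%N).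

Lemma arc_set_left : arc_set left_edge = [set ord0].
Proof. by apply/setP => -[[|[|u]] u2]; rewrite !inE. Qed.

Lemma arc_set_right : arc_set right_edge = [set ord_max].
Proof. by apply/setP => -[[|[|u]] u2]; rewrite !inE. Qed.

Lemma arc_set_base : arc_set base_arc = [set ord0; ord_max].
Proof. by apply/setP => -[[|[|u]] u2]; rewrite !inE. Qed.

Lemma symbol2P (U : symbol 1) : exists a, U = arc_symbol a.
Proof.
have setE (S T : {set 'I_2}) :
    (ord0 \in S) = (ord0 \in T) -> (ord_max \in S) = (ord_max \in T) -> S = T.
  move=> e0 e1; apply/setP => u.
  have [-> //|-> //] : u = ord0 \/ u = ord_max.
  by case: u => [[|[|u]] u2] //; [left|right]; apply: val_inj.
case U0: (ord0 \in val U); case U1: (ord_max \in val U).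
- by exists base_arc; apply/val_inj/setE; rewrite /= arc_set_base !inE.
- by exists left_edge; apply/val_inj/setE; rewrite /= arc_set_left !inE.
- by exists right_edge; apply/val_inj/setE; rewrite /= arc_set_right !inE.
by have /eqP[] := valP U; apply: setE; rewrite !inE.
Qed.

Lemma arc2P (a : arc 1) : [\/ a = left_edge, a = right_edge | a = base_arc].
Proof.
have : ((val a).1 < (val a).2)%N := valP a; have := ltn_ord (val a).2 => a2 a12.
have : ((val a).1 = 0 :> nat /\ (val a).2 = 1 :> nat) \/
  ((val a).1 = 1 :> nat /\ (val a).2 = 2 :> nat) \/
  ((val a).1 = 0 :> nat /\ (val a).2 = 2 :> nat) by lia.
move=> [[]|[[]|[]]] ? ?; [constructor 1|constructor 2|constructor 3]; exact: arc_eq.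
Qed.

Lemma mkfraction_arc n (s : seq (arc n)) (a : arc n) :
  mkfraction [::] (map (@arc_set n) s) (arc_symbol a) = - (count_mem a s)%:Z.
Proof.
rewrite ffunE sub0r count_map; congr (- (Posz _)); apply: eq_count => b /=.
exact: (inj_eq (@arc_set_inj n)).
Qed.

(** For fractions with numerator 1 and denominator indexed by [s]; the labels
    are the values of [2 e + 1], all three arcs being sides. *)
Lemma clique_fraction_triangle (s : seq (arc 1)) :
  clique_fraction (triangle (1 - (count_mem base_arc s)%:Z * 2)
    (1 - (count_mem left_edge s)%:Z * 2) (1 - (count_mem right_edge s)%:Z * 2)) =
  mkfraction [::] (map (@arc_set 1) s).
Proof.
apply/ffunP => U; have [a ->] := symbol2P U.
rewrite clique_fraction_arc mkfraction_arc /exponent.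
by have [->|->|->] := arc2P a; rewrite label_mk /= /nb_sides /=; lia.
Qed.

Theorem proposition5p1p2 (K : fieldType) (charK : [pchar K]%R =i pred0) :
  operad_isomorphic (OFF4 K) (FF4 K).
Proof.
have E1 : clique_fraction (triangle (-1) (-1) 1) =
    mkfraction [::] [:: [set ord0]; [set ord0; ord_max]].
  rewrite -arc_set_base -arc_set_left.
  by rewrite -(clique_fraction_triangle [:: left_edge; base_arc]).
have E2 : clique_fraction (triangle (-1) 1 (-1)) =
    mkfraction [::] [:: [set ord_max]; [set ord0; ord_max]].
  rewrite -arc_set_base -arc_set_right.
  by rewrite -(clique_fraction_triangle [:: right_edge; base_arc]).
have E3 : clique_fraction (triangle (-1) 1 1) =
    mkfraction [::] [:: [set ord0; ord_max]].
  by rewrite -arc_set_base -(clique_fraction_triangle [:: base_arc]).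
have E4 : clique_fraction (triangle 1 (-1) (-1)) =
    mkfraction [::] [:: [set ord0]; [set ord_max]].
  rewrite -arc_set_left -arc_set_right.
  by rewrite -(clique_fraction_triangle [:: left_edge; right_edge]).
have := @linear_operad_isomorphic K clique_operad fraction_operad even_clique
  clique_fraction [:: triangle (-1) (-1) 1; triangle (-1) 1 (-1);
    triangle (-1) 1 1; triangle 1 (-1) (-1)].
rewrite /= E1 E2 E3 E4; apply.
- exact: even_clique_unit.
- exact: even_clique_comp.
- exact: clique_fraction_unit.
- exact: clique_fraction_comp.
- exact: clique_fraction_inj.
- by move=> p; rewrite !inE => /or4P[] /eqP->; exact: even_triangle.
Qed.
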